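(* For every integer $n\geq 2$, the edge metric dimension of the crystal cubic carbon graph $CCS(n)$ is $\mathrm{edim}(CCS(n)) = 7^{n-2}\times 16$.
   Context: All graphs are finite, simple, connected and undirected; $d(u,v)$ denotes the shortest-path distance between vertices $u,v$. For an edge $e=ab$ and a vertex $h$, the distance is $d(e,h)=\min\{d(a,h),d(b,h)\}$. An ordered set $H$ of vertices of a graph $G=(V,E)$ is an edge metric generator (edge resolving set) if for every two distinct edges $e_1\neq e_2$ in $E$ there is a vertex $h\in H$ with $d(e_1,h)\neq d(e_2,h)$. The edge metric dimension $\mathrm{edim}(G)$ is the minimum cardinality of an edge metric generator of $G$. The crystal cubic carbon graphs $CCS(n)$ are defined recursively. $CCS(1)$ is a single cube, i.e. the graph of the 3-dimensional cube $Q_3$ (8 vertices of degree 3, 12 edges), called the central cube. For $n\geq 1$, $CCS(n+1)$ is obtained from $CCS(n)$ as follows: for every vertex $v$ of $CCS(n)$ of degree $3$, take a new disjoint copy of the cube graph $Q_3$ and add one edge (a bridge edge) joining $v$ to one vertex of this new cube. Thus $CCS(2)$ consists of the central cube with a new cube attached by a bridge edge at each of its 8 vertices, and $CCS(n)$ for $n\ge 2$ has $7^{n-2}\times 8$ outermost cubes (cubes added at the last step), and $7^{n-2}\times 8\times 7$ vertices of degree 3. *)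

(* Defs.v *)
From mathcomp Require Import all_boot.

Set Implicit Arguments.
Unset Strict Implicit.
Unset Printing Implicit Defensive.

Record cgraph := CGraph {
  vertex :> finType;
  adj : rel vertex;
  adj_sym : symmetric adj;
  adj_irr : irreflexive adj;
  adj_conn : forall u v, connect adj u v
}.
Arguments adj {c}.

Definition deg (G : cgraph) (v : G) : nat := #|[set w | adj v w]|.

Definition walk (G : cgraph) (u v : G) (k : nat) : bool :=
  [exists p : k.-tuple G, path adj u p && (last u p == v)].

Lemma walk_ex (G : cgraph) (u v : G) : exists k, walk u v k.
Proof.
have /connectP[p pp ->] := adj_conn u v.
by exists (size p); apply/existsP; exists (in_tuple p); rewrite pp eqxx.
Qed.

Definition dist (G : cgraph) (u v : G) : nat := ex_minn (walk_ex u v).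

Definition edist (G : cgraph) (a b h : G) : nat := minn (dist a h) (dist b h).

(* The edges are the unordered pairs [set a; b] with adj a b. *)
Definition edge_metric_generator (G : cgraph) (H : {set G}) : bool :=
  [forall a : G, forall b : G, forall c : G, forall d : G,
    [&& adj a b, adj c d & [set a; b] != [set c; d]] ==>
    [exists h in H, edist a b h != edist c d h]].

Lemma dist_eq0 (G : cgraph) (u v : G) : (dist u v == 0) = (u == v).
Proof.
rewrite /dist; case: ex_minnP => k wk kmin; apply/eqP/eqP => [k0 | uv].
  by move: wk; rewrite k0 => /existsP[p]; rewrite tuple0 => /eqP.
apply/eqP; rewrite -leqn0; apply: kmin; apply/existsP.
by exists [tuple]; rewrite /= uv eqxx.
Qed.

Lemma edist_eq0 (G : cgraph) (a b h : G) :
  (edist a b h == 0) = (h \in [set a; b]).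
Proof.
rewrite in_set2 !(eq_sym h) -!dist_eq0 /edist.
by case: (dist a h) (dist b h) => [|m] [|n]; rewrite ?minn0 ?min0n ?minnSS.
Qed.

Lemma edge_metric_generatorT (G : cgraph) :
  edge_metric_generator [set: G].
Proof.
do 4![apply/forallP => ?]; apply/implyP => /and3P[_ _].
apply: contraNT => /existsPn nh; apply/eqP/setP => h.
by have := nh h; rewrite in_setT /= negbK -!edist_eq0 => /eqP ->.
Qed.

(* The minimum is attained under the constraint, by edge_metric_generatorT. *)
Definition edim (G : cgraph) : nat :=
  #|[arg min_(H < [set: G] | edge_metric_generator H) #|H| ]|.

Definition q3 : finType := {ffun 'I_3 -> bool}.

Definition q3_adj (x y : q3) : bool := #|[set i | x i != y i]| == 1.

Lemma q3_adj_sym : symmetric q3_adj.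
Proof.
by move=> x y; congr (_ == 1); apply: eq_card => i; rewrite !inE eq_sym.
Qed.

Lemma q3_adj_irr : irreflexive q3_adj.
Proof.
move=> x; rewrite /q3_adj (_ : [set i | _] = set0) ?cards0 //.
by apply/setP => i; rewrite !inE eqxx.
Qed.

Lemma q3_adj_conn (x y : q3) : connect q3_adj x y.
Proof.
have [k] := ubnP #|[set i | x i != y i]|.
elim: k x => [|k IHk] x //; rewrite ltnS => lek.
have [xy | [i]] := set_0Vmem [set i | x i != y i].
  rewrite (_ : x = y) ?connect0 //; apply/ffunP => i; apply/eqP.
  by have := in_set0 i; rewrite -xy inE => /negbFE.
rewrite inE => xyi; pose z : q3 := [ffun j => if j == i then y i else x j].
apply: (@connect_trans _ _ z).
  apply: connect1; rewrite /q3_adj (_ : [set _ | _] = [set i]) ?cards1 //.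
  apply/setP => j; rewrite !inE ffunE.
  by case: (eqVneq j i) => [-> | _]; rewrite ?xyi ?eqxx.
apply: IHk; apply: leq_trans lek; apply: proper_card; apply/properP; split.
  apply/subsetP => j; rewrite !inE ffunE.
  by case: (eqVneq j i) => [-> | //]; rewrite eqxx.
by exists i; rewrite !inE ?ffunE ?eqxx.
Qed.

Definition cube : cgraph := CGraph q3_adj_sym q3_adj_irr q3_adj_conn.

Definition cube0 : cube := [ffun=> false].

(* inr (v, x) is the vertex x of the new cube attached at v.  The bridge ends
   at the vertex cube0 of that cube; as the cube is vertex-transitive, another
   choice gives an isomorphic graph. *)
Definition attach_vertex (G : cgraph) : finType :=
  (G + {v : G | deg v == 3} * cube)%type.

Definition attach_adj (G : cgraph) (p q : attach_vertex G) : bool :=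
  match p, q with
  | inl u, inl v => adj u v
  | inl u, inr (v, x) | inr (v, x), inl u => (u == val v) && (x == cube0)
  | inr (v, x), inr (w, y) => (v == w) && adj x y
  end.

Lemma attach_adj_sym (G : cgraph) : symmetric (@attach_adj G).
Proof.
case=> [u|[v x]] [w|[t y]] //=; first exact: adj_sym.
by rewrite q3_adj_sym (eq_sym v).
Qed.

Lemma attach_adj_irr (G : cgraph) : irreflexive (@attach_adj G).
Proof. by case=> [u|[v x]] /=; rewrite ?q3_adj_irr ?adj_irr ?andbF. Qed.

Lemma attach_adj_conn (G : cgraph) (p q : attach_vertex G) :
  connect (@attach_adj G) p q.
Proof.
have lift (K : cgraph) (f : K -> attach_vertex G) :
    {homo f : x y / adj x y >-> attach_adj x y} ->
    forall x y, connect (@attach_adj G) (f x) (f y).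
  move=> fK x y; have /connectP[r pr ->] := adj_conn x y.
  by apply/connectP; exists (map f r); rewrite ?last_map ?(homo_path fK).
have linl u v : connect (@attach_adj G) (inl u) (inl v) by apply: (lift G inl).
have csym := sym_connect_sym (@attach_adj_sym G).
have linr v x u : connect (@attach_adj G) (inr (v, x)) (inl u).
  apply: (@connect_trans _ _ (inr (v, cube0))).
    by apply: (lift cube (fun y => inr (v, y))) => y z /= ->; rewrite eqxx.
  apply: connect_trans (linl (val v) u).
  by apply: connect1; rewrite /= !eqxx.
case: p q => [u|[v x]] [w|[t y]] //; first by rewrite csym.
by apply: connect_trans (linr v x (val v)) _; rewrite csym.
Qed.

Definition attach_cubes (G : cgraph) : cgraph :=
  CGraph (@attach_adj_sym G) (@attach_adj_irr G) (@attach_adj_conn G).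

(* Meaningful for n >= 1; CCS 0 is a junk value, equal to CCS 1. *)
Definition CCS (n : nat) : cgraph := iter n.-1 attach_cubes cube.

(* Main.v *)
Require Import Defs.
From mathcomp Require Import all_boot.
From mathcomp Require Import zify.

(* A new cube is joined to the rest of the graph only through its vertex
   [cube0], so the landmarks outside that cube do not separate its three edges
   at [cube0], and a single landmark inside does not either: every new cube
   contains at least two landmarks.  Conversely, the landmarks 011 and 101 in
   every new cube suffice.  Within a cube, an outside landmark measures the
   distance to 000, and 000, 011, 101 resolve the edges of the cube; edges of
   the old graph are resolved because by induction its vertices of degree 3, at
   which the new cubes hang, form an edge metric generator; and edges of
   different kinds are told apart by how close they are to the two landmarks of
   one cube.  Since exactly 7 vertices of each new cube have degree 3 and no old
   vertex does, the number of new cubes grows by a factor 7. *)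

Set Implicit Arguments.
Unset Strict Implicit.
Unset Printing Implicit Defensive.

(** * Distances, generators and the dimension in an arbitrary graph *)

Section Distance.
Variable G : cgraph.
Implicit Types (u v w h : G) (A B : {set G}).

Lemma walk0 u v : walk u v 0 = (u == v).
Proof.
apply/existsP/idP => [[p]|uv]; first by rewrite tuple0.
by exists [tuple].
Qed.

Lemma walkS u v k : walk u v k.+1 = [exists w, adj u w && walk w v k].
Proof.
apply/existsP/existsP => [[p]|[w /andP[uw /existsP[p pw]]]].
  case/tupleP: p => w p /= /andP[/andP[uw pw] lw].
  by exists w; rewrite uw /=; apply/existsP; exists p; rewrite pw.
by exists [tuple of w :: p]; rewrite /= uw.
Qed.

Lemma dist_walk u v : walk u v (dist u v).
Proof. by rewrite /dist; case: ex_minnP. Qed.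

Lemma dist_le u v k : walk u v k -> dist u v <= k.
Proof. by rewrite /dist; case: ex_minnP => m _; apply. Qed.

Lemma dist_adj u w v : adj u w -> dist u v <= (dist w v).+1.
Proof.
move=> uw; apply: dist_le; rewrite walkS; apply/existsP; exists w.
by rewrite uw dist_walk.
Qed.

Lemma dist_descent u v :
  0 < dist u v -> exists2 w, adj u w & dist w v < dist u v.
Proof.
case E: (dist u v) => [//|k] _; have := dist_walk u v.
rewrite E walkS => /existsP[w /andP[uw wv]].
by exists w => //; rewrite ltnS dist_le.
Qed.

(** Descent yields a walk to [h] of length at most [f u], and the Lipschitz condition makes every
    such walk at least [f u] long. Distance formulas can thus be verified edge by edge. *)
Lemma dist_unique h (f : G -> nat) :
    f h = 0 -> (forall u w, adj u w -> f u <= (f w).+1) ->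
    (forall u, 0 < f u -> exists2 w, adj u w & f w < f u) ->
    (forall u, f u = 0 -> u = h) ->
  forall u, dist u h = f u.
Proof.
move=> fh fL fD f0 u; apply/eqP; rewrite eqn_leq; apply/andP; split.
  have [k] := ubnP (f u); elim: k u => [//|k IHk] u ltk.
  have [fu0|fu_gt0] := posnP (f u).
    by rewrite (f0 u fu0) fh leqn0 dist_eq0.
  have [w uw ltw] := fD u fu_gt0.
  apply: leq_trans (dist_adj h uw) (leq_ltn_trans _ ltw).
  exact: IHk (leq_trans ltw ltk).
move: (dist u h) (dist_walk u h) => k; elim: k u => [|k IHk] u.
  by rewrite walk0 => /eqP->; rewrite fh.
rewrite walkS => /existsP[w /andP[uw /IHk]]; have := fL _ _ uw; lia.
Qed.

Lemma edge_metric_generatorP A :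
  reflect (forall a b c d, adj a b -> adj c d ->
             {in A, forall h, edist a b h = edist c d h} ->
             [set a; b] = [set c; d])
          (edge_metric_generator A).
Proof.
apply: (iffP idP) => [gA a b c d ab cd eqA|gA].
  apply/eqP; apply: contraTT gA => abcd.
  rewrite negb_forall; apply/existsP; exists a.
  rewrite negb_forall; apply/existsP; exists b.
  rewrite negb_forall; apply/existsP; exists c.
  rewrite negb_forall; apply/existsP; exists d.
  rewrite ab cd abcd /= negb_exists; apply/forallP => h.
  by rewrite negb_and negbK -implybE; apply/implyP => /eqA->.
do 4![apply/forallP => ?]; apply/implyP => /and3P[ab cd].
apply: contraNT => /existsPn nh; apply/eqP/gA => // h hA.
by have := nh h; rewrite hA negbK => /eqP.
Qed.

Lemma edge_metric_generatorS A B :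
  A \subset B -> edge_metric_generator A -> edge_metric_generator B.
Proof.
move=> /subsetP sAB /edge_metric_generatorP gA.
apply/edge_metric_generatorP => a b c d ab cd eqB.
by apply: gA => // h /sAB; apply: eqB.
Qed.

Lemma edim_eq A :
    edge_metric_generator A ->
    (forall B, edge_metric_generator B -> #|A| <= #|B|) ->
  edim G = #|A|.
Proof.
move=> gA minA; rewrite /edim; case: arg_minnP => [|B gB minB].
  exact: edge_metric_generatorT.
by apply/eqP; rewrite eqn_leq minB ?minA.
Qed.

Lemma edistC a b h : edist a b h = edist b a h.
Proof. exact: minnC. Qed.

Lemma deg_sum v : deg v = \sum_w adj v w.
Proof. by rewrite /deg -sum1dep_card big_mkcond. Qed.

End Distance.

Definition deg3 (G : cgraph) : {set G} := [set v | deg v == 3].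

(** * The cube in coordinates and its two landmarks *)

Section Cube.
Implicit Types x y z : cube.

Let i0 : 'I_3 := @Ordinal 3 0 isT.
Let i1 : 'I_3 := @Ordinal 3 1 isT.
Let i2 : 'I_3 := @Ordinal 3 2 isT.

Lemma ord3P (P : 'I_3 -> Prop) : P i0 -> P i1 -> P i2 -> forall i, P i.
Proof.
move=> P0 P1 P2 [[|[|[|//]]] lti].
- by rewrite (_ : Ordinal lti = i0) //; apply: val_inj.
- by rewrite (_ : Ordinal lti = i1) //; apply: val_inj.
- by rewrite (_ : Ordinal lti = i2) //; apply: val_inj.
Qed.

(** Triples of booleans evaluate by computation, so that facts on the cube become exhaustive checks
    over the list [octants]. *)
Definition cube_of (t : bool * bool * bool) : cube :=
  [ffun i : 'I_3 => nth false [:: t.1.1; t.1.2; t.2] i].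

Definition bits x : bool * bool * bool := (x i0, x i1, x i2).

Lemma bitsK : cancel bits cube_of.
Proof. by move=> x; apply/ffunP; apply: ord3P; rewrite ffunE. Qed.

Lemma cube_ofK : cancel cube_of bits.
Proof. by case=> [[a b] c]; rewrite /bits !ffunE. Qed.

Definition hamming3 (s t : bool * bool * bool) : nat :=
  (s.1.1 != t.1.1) + (s.1.2 != t.1.2) + (s.2 != t.2).

Lemma adj_bits x y : adj x y = (hamming3 (bits x) (bits y) == 1).
Proof.
rewrite /adj /= /q3_adj -sum1dep_card big_mkcond !big_ord_recl big_ord0 /=.
have -> : ord0 = i0 by apply: val_inj.
have -> : lift i0 ord0 = i1 by apply: val_inj.
have -> : lift i0 (lift ord0 ord0) = i2 by apply: val_inj.
rewrite /hamming3 /=.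
by case: (x i0 == y i0); case: (x i1 == y i1); case: (x i2 == y i2).
Qed.

Lemma dist_cube x y : dist x y = hamming3 (bits x) (bits y).
Proof.
move: x; apply: dist_unique => [|u w|u|u].
- by rewrite /hamming3 !eqxx.
- rewrite adj_bits; move: (bits u) (bits w) (bits y) => a b c.
  move/eqP; move: a b c.
  by do 3!case=> [[[] []] []].
- have desc (s t : bool * bool * bool) : 0 < hamming3 s t ->
      {r | hamming3 s r = 1 & hamming3 r t < hamming3 s t}.
    move: s t => [[a b] c] [[a' b'] c']; rewrite /hamming3 /=.
    have [->|neq_a _] := eqVneq a a'; last first.
      by exists (a', b, c); rewrite /= !eqxx ?(negPf neq_a) ?neq_a.
    have [->|neq_b _] := eqVneq b b'; last first.
      by exists (a', b', c); rewrite /= !eqxx ?neq_b.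
    have [->//|neq_c _] := eqVneq c c'.
    by exists (a', b', c'); rewrite /= !eqxx ?neq_c.
  case/desc=> r sr rt; exists (cube_of r); last by rewrite cube_ofK.
  by rewrite adj_bits cube_ofK sr.
- move=> uy; apply: (can_inj bitsK); move: uy; case: (bits u) => [[a b] c].
  by case: (bits y) => [[a' b'] c']; case: a a' b b' c c' => [] [] [] [] [] [].
Qed.

Let octants : seq (bool * bool * bool) :=
  let bools := [:: false; true] in
  [seq (p, c) | p <- [seq (a, b) | a <- bools, b <- bools], c <- bools].

Lemma mem_octants t : t \in octants.
Proof. by case: t => [[[] []] []]. Qed.

(** [lmark true] is 011 and [lmark false] is 101. *)
Definition lmark (b : bool) : cube := cube_of (~~ b, b, true).

Let cube0E : bits cube0 = (false, false, false).
Proof. by rewrite /bits !ffunE. Qed.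

Lemma dist_cube0_lmark b : dist cube0 (lmark b) = 2.
Proof. by rewrite dist_cube cube0E cube_ofK; case: b. Qed.

Lemma lmark_inj : injective lmark.
Proof. by move=> b c /(can_inj cube_ofK) [_ ->]. Qed.

Lemma lmark_neq0 b : lmark b != cube0.
Proof. by rewrite -dist_eq0 dist_cube cube0E cube_ofK; case: b. Qed.

(** Only the antipode of the landmark is at distance 3, and an edge has another endpoint. *)
Lemma edist_lmark_le x y b : adj x y -> edist x y (lmark b) <= 2.
Proof.
rewrite adj_bits /edist !dist_cube cube_ofK => xy.
have /allP/(_ _ (mem_octants (bits x)))/allP/(_ _ (mem_octants (bits y))) :
    all (fun s => all (fun t => (hamming3 s t == 1) ==>
      (minn (hamming3 s (~~ b, b, true)) (hamming3 t (~~ b, b, true)) <= 2))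
    octants) octants by case: b; vm_compute.
by rewrite xy.
Qed.

(** Only 000 and 110 are at distance at least 2 from both landmarks, and they are not adjacent. This
    separates the edges of a cube from its bridge, which is at distance 2 from both. *)
Lemma edist_lmark_lt x y :
  adj x y -> edist x y (lmark false) + edist x y (lmark true) <= 3.
Proof.
rewrite adj_bits /edist !dist_cube !cube_ofK => xy.
have /allP/(_ _ (mem_octants (bits x)))/allP/(_ _ (mem_octants (bits y))) :
    all (fun s => all (fun t => (hamming3 s t == 1) ==>
      (minn (hamming3 s (true, false, true)) (hamming3 t (true, false, true)) +
       minn (hamming3 s (false, true, true)) (hamming3 t (false, true, true))
         <= 3))
    octants) octants by vm_compute.
by rewrite xy.
Qed.

Lemma cube_lmark_resolving x y z t : adj x y -> adj z t ->
    edist x y cube0 = edist z t cube0 ->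
    (forall b, edist x y (lmark b) = edist z t (lmark b)) ->
  [set x; y] = [set z; t].
Proof.
rewrite !adj_bits /edist !dist_cube cube0E => xy zt e0 el.
have := el true; have := el false; rewrite !dist_cube !cube_ofK => ef et.
pose e s s' r := minn (hamming3 s r) (hamming3 s' r).
have /allP/(_ _ (mem_octants (bits x)))/allP/(_ _ (mem_octants (bits y)))
     /allP/(_ _ (mem_octants (bits z)))/allP/(_ _ (mem_octants (bits t))) :
    all (fun sx => all (fun sy => all (fun sz => all (fun st =>
      [&& hamming3 sx sy == 1, hamming3 sz st == 1,
          e sx sy (false, false, false) == e sz st (false, false, false),
          e sx sy (true, false, true) == e sz st (true, false, true) &
          e sx sy (false, true, true) == e sz st (false, true, true)] ==>
      ((sx == sz) && (sy == st) || (sx == st) && (sy == sz)))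
    octants) octants) octants) octants by vm_compute.
rewrite /e xy zt e0 ef et !eqxx /= !(inj_eq (can_inj bitsK)).
by case/orP=> /andP[/eqP-> /eqP->] //; rewrite setUC.
Qed.

(* Only two values are possible for the distance from an edge at [cube0] to a
   fixed vertex, and there are three such edges. *)
Lemma cube0_edges_unresolved x : exists y z,
  [/\ adj cube0 y, adj cube0 z, y != z & edist cube0 y x = edist cube0 z x].
Proof.
have /allP/(_ _ (mem_octants (bits x)))/hasP[s _
      /hasP[t _ /and4P[s1 t1 st e]]] :
    all (fun r => has (fun s => has (fun t =>
      [&& hamming3 (false, false, false) s == 1,
          hamming3 (false, false, false) t == 1, s != t &
          minn (hamming3 (false, false, false) r) (hamming3 s r) ==
          minn (hamming3 (false, false, false) r) (hamming3 t r)])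
    octants) octants) octants by vm_compute.
exists (cube_of s), (cube_of t).
rewrite !adj_bits /edist !dist_cube cube0E !cube_ofK.
rewrite (inj_eq (can_inj cube_ofK)).
by split=> //; apply/eqP.
Qed.

Lemma deg_cube x : deg x = 3.
Proof.
rewrite deg_sum (reindex cube_of); last first.
  by exists bits => ? _; rewrite ?cube_ofK ?bitsK.
under eq_bigr => t _ do rewrite adj_bits cube_ofK.
(* Over the explicit list [octants] the sum can be evaluated. *)
rewrite -(@big_enum _ _ _ _ predT) (perm_big octants) /=; last first.
  apply: uniq_perm; rewrite ?enum_uniq // => t.
  by rewrite mem_octants mem_enum.
by rewrite unlock; case: (bits x) => [[[] []] []].
Qed.

End Cube.

(** * Distances after attaching cubes *)

Section Attach.
Variable G : cgraph.
Local Notation host := {v : G | deg v == 3}.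
Implicit Types (u w : G) (v : host) (x y : cube).

Lemma card_host : #|{: host}| = #|deg3 G|.
Proof. by rewrite card_sig; apply: eq_card => v; rewrite !inE. Qed.

Definition old u : attach_cubes G := inl u.
Definition new v x : attach_cubes G := inr (v, x).

Lemma adj_new v x y : adj x y -> adj (new v x) (new v y).
Proof. by move=> xy; rewrite /= eqxx. Qed.

(** Each successor counts a bridge, which a path entering or leaving a new cube has to cross at
    [cube0]. The target comes first so that [attach_dist h] fits [dist_unique]. *)
Definition attach_dist (h p : attach_cubes G) : nat :=
  match h, p with
  | inl w, inl u => dist u w
  | inl w, inr (v, x) => (dist x cube0).+1 + dist (val v) w
  | inr (v, y), inl u => dist u (val v) + (dist cube0 y).+1
  | inr (v, y), inr (v', x) =>
    if v' == v then dist x y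
    else (dist x cube0).+1 + dist (val v') (val v) + (dist cube0 y).+1
  end.

Lemma dist_attach (p h : attach_cubes G) : dist p h = attach_dist h p.
Proof.
have d0 (K : cgraph) (a : K) : dist a a = 0 by apply/eqP; rewrite dist_eq0.
have d0P (K : cgraph) (a b : K) : dist a b = 0 -> a = b.
  by move/eqP; rewrite dist_eq0 => /eqP.
have adj_bridge v : adj (old (val v)) (new v cube0) by rewrite /= !eqxx.
move: p; apply: dist_unique.
- by case: h => [w|[v y]] /=; rewrite ?eqxx d0.
- case=> [u|[v x]] [u'|[v' x']] /=.
  + by move=> uu'; case: h => [w|[w y]];
      rewrite -?addSn ?leq_add2r; apply: dist_adj.
  + case/andP=> /eqP-> /eqP->; case: h => [w|[w y]] /=; rewrite d0; first lia.
    by case: eqVneq => [->|_]; rewrite ?d0; lia.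
  + case/andP=> /eqP-> /eqP->; case: h => [w|[w y]] /=; rewrite d0; first lia.
    by case: eqVneq => [->|_]; rewrite ?d0; lia.
  + case/andP=> /eqP<- xx'; case: h => [w|[w y]] /=.
      by have := dist_adj cube0 xx'; lia.
    by case: ifP => _; [apply: dist_adj | have := dist_adj cube0 xx'; lia].
(* One step towards [cube0], or over the bridge once there, comes closer to all targets outside the
   cube at once. *)
- have out v x : exists2 q, adj (new v x) q &
      forall h, (if h is inr (w, y) then v != w else true) ->
        attach_dist h q < attach_dist h (new v x).
    have [/d0P->|/dist_descent[x' xx' lt]] := posnP (dist x cube0).
      exists (old (val v)); first by rewrite adj_sym.
      case=> [w _|[w y] /negPf vw] /=; rewrite d0 ?vw //; lia.
    exists (new v x'); first exact: adj_new.
    case=> [w _|[w y] /negPf vw] /=; rewrite ?vw //; lia.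
  case=> [u|[v x]]; last first.
    case: h => [w|[w y]] => [_|].
      by have [q vq /(_ (old w) isT)] := out v x; exists q.
    have [->|vw _] := eqVneq v w; last first.
      by have [q vq /(_ (new w y) vw)] := out v x; exists q.
    rewrite /= eqxx => /dist_descent[x' xx' lt].
    by exists (new w x') => [|/=]; [apply: adj_new | rewrite eqxx].
  case: h => [w|[w y]] /=.
    by case/dist_descent=> u' uu' lt; exists (old u').
  have [/d0P-> _|/dist_descent[u' uu' lt] _] := posnP (dist u (val w)).
    exists (new w cube0) => [|/=]; first exact: adj_bridge.
    by rewrite eqxx d0; lia.
  by exists (old u') => //=; rewrite ltn_add2r.
- case: h => [w|[w y]] [u|[v x]] /=; rewrite ?addnS //; first by move/d0P->.
  by case: eqVneq => // -> /d0P->.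
Qed.

(** The 3 is the bridge plus the distance 2 from [cube0] to a landmark; so old edges are at distance
    at least 3 from all landmarks. *)
Lemma edist_old u u' v b :
  edist (old u) (old u') (new v (lmark b)) = edist u u' (val v) + 3.
Proof. by rewrite /edist !dist_attach /= dist_cube0_lmark addn_minl. Qed.

Lemma edist_bridge v b :
  edist (old (val v)) (new v cube0) (new v (lmark b)) = 2.
Proof.
rewrite /edist !dist_attach /= eqxx dist_cube0_lmark; apply/minn_idPr; lia.
Qed.

Lemma edist_bridge_neq v v' b : v != v' ->
  2 < edist (old (val v)) (new v cube0) (new v' (lmark b)).
Proof.
move/negPf=> vv'.
rewrite /edist !dist_attach /= vv' dist_cube0_lmark leq_min; lia.
Qed.

Lemma edist_new v x y z : edist (new v x) (new v y) (new v z) = edist x y z.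
Proof. by rewrite /edist !dist_attach /= eqxx. Qed.

(** The second summand does not depend on the edge: a vertex of another new cube sees only the
    distance of the edge to [cube0]. *)
Lemma edist_new_neq v v' x y z : v != v' ->
  edist (new v x) (new v y) (new v' z) =
  edist x y cube0 + (dist (val v) (val v') + (dist cube0 z).+2).
Proof.
move/negPf=> vv'; rewrite /edist !dist_attach /= vv' !addSn -!addnA addn_minl.
lia.
Qed.

Lemma edist_cube0_old v x u :
  edist (new v cube0) (new v x) (old u) = (dist (val v) u).+1.
Proof.
have d0 : dist cube0 cube0 = 0 by apply/eqP; rewrite dist_eq0.
by rewrite /edist !dist_attach /= d0; lia.
Qed.

(** * The three kinds of edges *)

(** Indexing by the edge as a set and by its distance function makes a case analysis rewrite both,
    and merges the two orientations of a bridge. *)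
Variant edge_spec : {set attach_cubes G} -> (attach_cubes G -> nat) -> Prop :=
  | OldEdge u u' of adj u u' :
      edge_spec [set old u; old u'] (edist (old u) (old u'))
  | Bridge v :
      edge_spec [set old (val v); new v cube0]
                (edist (old (val v)) (new v cube0))
  | NewEdge v x y of adj x y :
      edge_spec [set new v x; new v y] (edist (new v x) (new v y)).

Lemma edgeP (p q : attach_cubes G) :
  adj p q -> exists2 d, edge_spec [set p; q] d & d =1 edist p q.
Proof.
case: p q => [u|[v x]] [u'|[v' x']] /=.
- by exists (edist (old u) (old u')) => //; constructor.
- case/andP=> /eqP-> /eqP->.
  by exists (edist (old (val v')) (new v' cube0)) => //; constructor.
- case/andP=> /eqP-> /eqP->; rewrite setUC.
  exists (edist (old (val v)) (new v cube0)) => [|h]; last exact: edistC.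
  by constructor.
- case/andP=> /eqP<- xx'.
  by exists (edist (new v x) (new v x')) => //; constructor.
Qed.

(** * Upper bound: two landmarks in every new cube *)

Definition landmarks : {set attach_cubes G} :=
  [set new p.1 (lmark p.2) | p in [set: host * bool]].

Lemma card_landmarks : #|landmarks| = 2 * #|deg3 G|.
Proof.
rewrite card_imset => [|[v b] [v' b']]; last first.
  by case=> -> /lmark_inj->.
by rewrite cardsT card_prod card_bool mulnC card_host.
Qed.

Lemma new_landmark v b : new v (lmark b) \in landmarks.
Proof. by apply/imsetP; exists (v, b). Qed.

Lemma landmarks_generator :
  edge_metric_generator (deg3 G) -> 1 < #|deg3 G| ->
  edge_metric_generator landmarks.
Proof.
move=> /edge_metric_generatorP gen gt1.
(* A second new cube supplies the outside landmark that measures distances to [cube0]. *)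
have other v : exists v', v != v'.
  have : 0 < #|deg3 G :\ val v|.
    by move: gt1; rewrite (cardsD1 (val v)); case: (_ \in _); lia.
  case/card_gt0P=> u; rewrite !inE => /andP[uv u3].
  by exists (Sub u u3); apply: contraNneq uv => ->.
apply/edge_metric_generatorP => a b c d ab cd eqL.
have [f fS fE] := edgeP ab; have [g gS gE] := edgeP cd.
have {eqL fE gE}: forall v e, f (new v (lmark e)) = g (new v (lmark e)).
  by move=> v e; rewrite fE gE eqL ?new_landmark.
have new_le2 v x y e : adj x y ->
    edist (new v x) (new v y) (new v (lmark e)) <= 2.
  by move=> xy; rewrite edist_new; apply: edist_lmark_le.
have old_bridge u u' (w : host) :
    ~ (forall v e, edist (old u) (old u') (new v (lmark e)) =
         edist (old (val w)) (new w cube0) (new v (lmark e))).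
  by move/(_ w true); rewrite edist_bridge edist_old; lia.
have old_new u u' (w : host) x y : adj x y ->
    ~ (forall v e, edist (old u) (old u') (new v (lmark e)) =
         edist (new w x) (new w y) (new v (lmark e))).
  by move=> /(new_le2 w) le2 /(_ w true) E; have := le2 true;
    rewrite -E edist_old; lia.
have bridge_new v (w : host) x y : adj x y ->
    ~ (forall v' e, edist (old (val v)) (new v cube0) (new v' (lmark e)) =
         edist (new w x) (new w y) (new v' (lmark e))).
  move=> xy; have [->|vw] := eqVneq v w => E.
    (* The bridge would give 2 + 2 where the sum is at most 3. *)
    by have := edist_lmark_lt xy; rewrite -!(edist_new w) -!E !edist_bridge.
  have := new_le2 w x y true xy; rewrite -E.
  by have := edist_bridge_neq true vw; lia.
case: fS => [u u' uu'|v|v x y xy]; case: gS => [w w' ww'|w|w z t zt] E.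
- have imold p q : [set old p; old q] = old @: [set p; q].
    by rewrite imsetU1 imset_set1.
  rewrite !imold (gen u u' w w') // => v v3.
  rewrite inE in v3.
  (* Cancelling the 3 turns a landmark in the cube at [v] into the vertex [v] itself, a landmark of
     the old generator. *)
  by have := E (Sub v v3) true; rewrite !edist_old /= => /addIn.
- by case: (old_bridge _ _ _ E).
- by case: (old_new _ _ _ _ _ zt E).
- by case: (old_bridge w w' v) => *; rewrite E.
- have [->//|vw] := eqVneq v w.
  have := edist_bridge_neq true vw; rewrite E edist_bridge; lia.
- by case: (bridge_new _ _ _ _ zt E).
- by case: (old_new w w' v x y) => *; rewrite ?E.
- by case: (bridge_new w v x y) => *; rewrite ?E.
- have [vw|vw] := eqVneq v w; last first.
    (* From a landmark in the cube at [w], an edge of another new cube is at distance at least 4, an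
       edge of its own at most 2. *)
    have := new_le2 w z t true zt; rewrite -E edist_new_neq // dist_cube0_lmark.
    lia.
  have imnew p q : [set new v p; new v q] = new v @: [set p; q].
    by rewrite imsetU1 imset_set1.
  move: E; rewrite -{w}vw => E; rewrite !imnew (cube_lmark_resolving xy zt) //.
    have [v' vv'] := other v.
    by have := E v' true; rewrite !edist_new_neq // => /addIn.
  by move=> e; have := E v e; rewrite !edist_new.
Qed.

(** * Lower bound: two landmarks are needed in every new cube *)

(* All paths from outside the cube at [v] enter it through [cube0], so only
   landmarks inside that cube can separate its three edges at [cube0]. *)
Lemma generator_cube (H : {set attach_cubes G}) v :
  edge_metric_generator H -> 1 < #|[set x | new v x \in H]|.
Proof.
move=> /edge_metric_generatorP gen; rewrite ltnNge; apply/negP => le1.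
(* [x] is the only possible landmark in this cube; if there is none, [cube0] serves as a default. *)
have [x Hx] : exists x, forall y, new v y \in H -> y = x.
  have [E|[x xH]] := set_0Vmem [set x | new v x \in H].
    by exists cube0 => y yH; have := in_set0 y; rewrite -E inE yH.
  exists x => y yH; apply: (card_le1_eqP le1) => //.
  by rewrite inE.
have [y [z [y0 z0 /eqP yz e]]] := cube0_edges_unresolved x.
apply: yz; have : new v y \in [set new v cube0; new v z].
  rewrite -(gen _ _ _ _ (adj_new v y0) (adj_new v z0)) ?set22 //.
  case=> [u _|[w t] tH]; first by rewrite !edist_cube0_old.
  have [vw|vw] := eqVneq v w.
    by move: tH; rewrite -vw => /Hx->; rewrite !edist_new.
  have d0 t' : edist cube0 t' cube0 = 0.
    by apply/eqP; rewrite edist_eq0 set21.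
  by rewrite !edist_new_neq // !d0.
rewrite !inE => /orP[/eqP[y_eq]|/eqP[]//].
by move: y0; rewrite y_eq adj_irr.
Qed.

Lemma generator_card (H : {set attach_cubes G}) :
  edge_metric_generator H -> 2 * #|deg3 G| <= #|H|.
Proof.
move=> gen; pose K := [set p : host * cube | new p.1 p.2 \in H].
have newI : injective (fun p : host * cube => new p.1 p.2).
  by move=> [v x] [w y] [-> ->].
have leKH : #|K| <= #|H|.
  rewrite -(card_imset _ newI); apply: subset_leq_card.
  by apply/subsetP => _ /imsetP[p pK ->]; rewrite inE in pK.
(* The landmarks in new cubes are counted cube by cube. *)
apply: leq_trans leKH; rewrite -[#|K|]sum1_card (partition_big fst predT) //=.
rewrite -card_host mulnC -sum_nat_const; apply: leq_sum => v _.
apply: leq_trans (generator_cube v gen) _.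
rewrite sum1dep_card -(@card_imset _ _ (pair v)) => [|x y []//].
apply: subset_leq_card; apply/subsetP => _ /imsetP[x xH ->].
by move: xH; rewrite !inE eqxx andbT.
Qed.

Lemma edim_attach :
  edge_metric_generator (deg3 G) -> 1 < #|deg3 G| ->
  edim (attach_cubes G) = 2 * #|deg3 G|.
Proof.
move=> gen gt1; rewrite -card_landmarks; apply: edim_eq => [|H genH].
  exact: landmarks_generator.
by rewrite card_landmarks generator_card.
Qed.

(** * Degrees and the number of vertices of degree 3 *)

Lemma deg_attach (p : attach_cubes G) :
  deg p = \sum_u adj p (old u) + \sum_v \sum_x adj p (new v x).
Proof.
rewrite deg_sum pair_big; etransitivity; first exact: big_sumType.
by congr (_ + _); apply: eq_big => [[v x]|[v x] _].
Qed.

(** Exactly the vertices of degree 3 gain a bridge and pass to degree 4, so no old vertex has degree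
    3 afterwards. *)
Lemma deg_old u : deg (old u) = deg u + (deg u == 3).
Proof.
rewrite deg_attach deg_sum; congr (_ + _) => /=.
have inner v : \sum_x ((u == val v) && (x == cube0)) = (u == val v) :> nat.
  rewrite (bigD1 cube0) //= big1 ?addn0 ?eqxx ?andbT // => x /negPf->.
  by rewrite andbF.
rewrite (eq_bigr _ (fun v _ => inner v)) -deg_sum.
case: (boolP (deg u == 3)) => u3.
  rewrite (bigD1 (Sub u u3)) //= eqxx big1 // => v neq_v.
  apply/eqP; rewrite eqb0; apply: contra neq_v => /eqP uv.
  by apply/eqP/val_inj; rewrite SubK.
rewrite big1 // => v _; apply/eqP; rewrite eqb0.
by apply: contra u3 => /eqP->; exact: (valP v).
Qed.

Lemma deg_new v x : deg (new v x) = 3 + (x == cube0).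
Proof.
rewrite deg_attach /= addnC; congr (_ + _).
  rewrite (bigD1 v) //= [X in _ + X]big1 => [|w /negPf neq_w]; last first.
    by rewrite big1 // => y _; rewrite eq_sym neq_w.
  by rewrite addn0 eqxx -[RHS](deg_cube x) deg_sum.
by rewrite (bigD1 (val v)) //= eqxx big1 ?addn0 // => u /negPf->.
Qed.

Lemma card_deg3_attach : #|deg3 (attach_cubes G)| = 7 * #|deg3 G|.
Proof.
have -> : deg3 (attach_cubes G) =
    [set new p.1 p.2 | p in setX [set: host] [set~ cube0]].
  apply/setP => p; apply/idP/imsetP => [|[[v x]]]; last first.
    by rewrite !inE /= => /negPf x0 ->; rewrite deg_new x0.
  rewrite inE; case: p => [u|[v x]].
    rewrite deg_old; case: (deg u =P 3) => [->|/eqP/negPf u3] //.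
    by rewrite addn0 u3.
  rewrite (deg_new v x) => x0; exists (v, x) => //; rewrite !inE /=.
  by case: (x == cube0) x0.
rewrite card_imset => [|[v x] [w y] [-> ->]//].
rewrite cardsX cardsT cardsC1 card_ffun card_bool card_ord.
by rewrite card_host mulnC.
Qed.

(** The landmarks avoid [cube0], the only vertex of a new cube with degree 4. Hence the vertices of
    degree 3 again form a generator, which closes the induction. *)
Lemma landmarks_deg3 : landmarks \subset deg3 (attach_cubes G).
Proof.
apply/subsetP => _ /imsetP[[v b] _ ->].
by rewrite inE deg_new (negPf (lmark_neq0 b)).
Qed.

End Attach.

(** * Induction along the crystal cubic carbon graphs *)

(** Both claims are proved together, since the count ensures that there are at least two new cubes,
    as [landmarks_generator] requires. *)
Lemma CCS_deg3 n : #|deg3 (CCS n.+1)| = 8 * 7 ^ n /\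
  edge_metric_generator (deg3 (CCS n.+1)).
Proof.
elim: n => [|n [IHc IHg]].
  have -> : deg3 (CCS 1) = [set: cube].
    by apply/setP => x; rewrite !inE deg_cube.
  by rewrite cardsT card_ffun card_bool card_ord edge_metric_generatorT.
split; first by rewrite (card_deg3_attach (CCS n.+1)) IHc expnS; lia.
apply: edge_metric_generatorS (landmarks_deg3 _) _.
by apply: landmarks_generator => //; rewrite IHc; have := expn_gt0 7 n; lia.
Qed.

Theorem theorem2 (n : nat) (n_ge2 : 2 <= n) : edim (CCS n) = 7 ^ (n - 2) * 16.
Proof.
(* The graph is now [CCS n.+2], built on [CCS n.+1] with its 8 * 7 ^ n vertices of degree 3; twice
   that number is the claim. *)
case: n n_ge2 => [|[|n]] // _; have [cn gn] := CCS_deg3 n.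
rewrite (edim_attach gn) ?cn; last by have := expn_gt0 7 n; lia.
by rewrite !subSS subn0; lia.
Qed.
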